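(* Let $(R,\mathfrak{m})$ be a $d$-dimensional Noetherian local ring with infinite residue field, let $F=R^p$ with $p>0$, and let $M$ be a finitely generated $R$-submodule of $F$ with $\ell_R(F/M)<\infty$ and analytic spread $s=s(M)\geq 1$. Let $I(M)=\operatorname{Fitt}_0(F/M)$. Then, for each $k=1,\ldots,s$, there exists a unique largest $R$-module $M_{[k]}$ with $I(M)M\subseteq M_{[k]}\subseteq M$ such that, for $n\gg0$, $$\deg\left[\ell_R\left(\frac{M_{[k]}M^{n-1}}{I(M)M^n}\right)\right]\leq s-(k+1).$$ Moreover, $$I(M)M\subseteq M_{[s]}\subseteq M_{[s-1]}\subseteq\cdots\subseteq M_{[1]}\subseteq M.$$
   Context: $F=R^p$ is free of rank $p>0$ and $S=\operatorname{Sym}_R(F)=R[t_1,\ldots,t_p]$ with $F=S_1$, $F^n=S_n$. For an $R$-submodule $N\subseteq F$, the Rees algebra $\mathscr{R}(N)=\bigoplus_{n\ge 0}N^n$ is the $R$-subalgebra of $S$ generated by $N$ in degree 1; $N^n\subseteq F^n$ is its degree $n$ component. All products are taken in $S$. The analytic spread is $s(N)=\dim\left(\mathscr{R}(N)/\mathfrak{m}\mathscr{R}(N)\right)$. $I(M)=\operatorname{Fitt}_0(F/M)$ is the $0$-th Fitting ideal of $F/M$. For an $R$-module $L$ with $I(M)M\subseteq L\subseteq M$, the function $n\mapsto \ell_R(LM^{n-1}/I(M)M^n)$ agrees for all large $n$ with a polynomial in $n$ of degree at most $s-1$; $\deg[\ell_R(LM^{n-1}/I(M)M^n)]$ denotes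 the degree of that polynomial. The zero polynomial is given degree $-1$, so degree $\le -1$ means the polynomial is zero. *)

(* Defs.v *)
From HB Require Import structures.
From mathcomp Require Import all_boot all_order all_algebra.
From mathcomp Require Import mathcomp_extra boolp classical_sets cardinality.
From mathcomp Require Import mpoly.

Set Implicit Arguments.
Unset Strict Implicit.
Unset Printing Implicit Defensive.

Import Order.TTheory GRing.Theory Num.Theory.
Local Open Scope classical_set_scope.
Local Open Scope ring_scope.

(* Submodules, ideals and subalgebras are classical sets in an ambient module
   or ring. A quotient A / B is never formed as a type: its submodules are
   given as the submodules between B and A, its prime ideals as the primes
   of A containing B. *)

Section Modules.
Variables (R : comNzRingType) (V : lmodType R).

Definition submodule (N : set V) : Prop := submod_closed (mem N).

Definition mspan (X : set V) : set V := smallest submodule X.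

Definition fin_gen (N : set V) : Prop :=
  exists X : seq V, N = mspan [set` X].

Definition ideal_mul (I : set R) (N : set V) : set V :=
  mspan [set a *: x | a in I & x in N].

Definition submodule_chain (A B : set V) (l : nat) (C : nat -> set V) : Prop :=
  [/\ C 0%N = B, C l = A,
      forall i, (i <= l)%N -> submodule (C i)
    & forall i, (i < l)%N -> C i `<` C i.+1].

(* A / B has finite length, equal to l *)
Definition module_length (A B : set V) (l : nat) : Prop :=
  (exists C, submodule_chain A B l C) /\
  (forall l' C, submodule_chain A B l' C -> (l' <= l)%N).

End Modules.

Section Rings.
Variable S : comNzRingType.

(* P is an ideal of the subring A of S *)
Definition ideal_of (A P : set S) : Prop :=
  [/\ P `<=` A, P 0, forall x y, P x -> P y -> P (x + y)
    & forall a x, A a -> P x -> P (a * x)].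

Definition prime_of (A P : set S) : Prop :=
  [/\ ideal_of A P, ~ P 1
    & forall x y, A x -> A y -> P (x * y) -> P x \/ P y].

Definition prime_chain (A J : set S) (l : nat) (C : nat -> set S) : Prop :=
  (forall i, (i <= l)%N -> prime_of A (C i) /\ J `<=` C i) /\
  (forall i, (i < l)%N -> C i `<` C i.+1).

(* the Krull dimension of A / J is the natural number n *)
Definition krull_dim (A J : set S) (n : nat) : Prop :=
  (exists C, prime_chain A J n C) /\
  (forall l C, prime_chain A J l C -> (l <= n)%N).

Definition noetherian : Prop :=
  forall I : set S, ideal_of setT I -> @fin_gen S S^o I.

Definition maximal_ideal (I : set S) : Prop :=
  [/\ ideal_of setT I, ~ I 1
    & forall J, ideal_of setT J -> ~ J 1 -> I `<=` J -> J = I].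

Definition local_ring (m : set S) : Prop :=
  maximal_ideal m /\ (forall m', maximal_ideal m' -> m' = m).

(* the set S / I of cosets x + I *)
Definition cosets (I : set S) : set (set S) :=
  [set [set y | I (y - x)] | x in setT].

End Rings.

Section ReesAlgebra.
Variables (R : comNzRingType) (p : nat).

(* the identification of R^p with the degree 1 part of R[t_1, ..., t_p] *)
Definition linform (v : 'rV[R]_p) : {mpoly R[p]} :=
  \sum_(i < p) v 0 i *: 'X_i.

Definition rees (N : set 'rV[R]_p) : set {mpoly R[p]} :=
  smallest (fun A : set {mpoly R[p]} => subalg_closed (mem A)) (linform @` N).

(* N^n *)
Definition rees_pow (N : set 'rV[R]_p) (n : nat) : set {mpoly R[p]} :=
  [set f | rees N f /\ f \is n.-homog].

(* L N^n *)
Definition mul_rees_pow (L N : set 'rV[R]_p) (n : nat) : set {mpoly R[p]} :=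
  mspan [set linform v * f | v in L & f in rees_pow N n].

Definition analytic_spread (m : set R) (N : set 'rV[R]_p) (s : nat) : Prop :=
  krull_dim (rees N) (ideal_mul m (rees N)) s.

(* Fitt_0 (R^p / N): the maximal minors of the relation matrices for the
   generators e_1, ..., e_p of R^p / N; the relations are the vectors of N. *)
Definition fitt0 (N : set 'rV[R]_p) : set R :=
  @mspan R R^o [set \det A | A in [set A : 'M[R]_p | forall i, N (row i A)]].

(* the length of L N^(n-1) / I(N) N^n is l *)
Definition coef_length (N L : set 'rV[R]_p) (n l : nat) : Prop :=
  module_length (mul_rees_pow L N n.-1)
                (ideal_mul (fitt0 N) (rees_pow N n)) l.

(* For large n that length is P(n) for a polynomial P of degree e, where
   the zero polynomial has degree -1. *)
Definition coef_length_degree (N L : set 'rV[R]_p) (e : int) : Prop :=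
  exists P : {poly rat},
    (exists n0, forall n, (n0 <= n)%N ->
       exists l, coef_length N L n l /\ l%:R = P.[n%:R]) /\
    e = (size P)%:Z - 1.

Definition coef_admissible (M : set 'rV[R]_p) (s k : nat)
    (L : set 'rV[R]_p) : Prop :=
  [/\ submodule L, ideal_mul (fitt0 M) M `<=` L, L `<=` M
    & exists e, coef_length_degree M L e /\ e <= s%:Z - k.+1%:Z].

Definition coef_module (M : set 'rV[R]_p) (s k : nat)
    (L : set 'rV[R]_p) : Prop :=
  coef_admissible M s k L /\
  (forall L', coef_admissible M s k L' -> L' `<=` L).

End ReesAlgebra.

(* Main.v *)
Require Import Defs.
From mathcomp Require Import all_boot all_order all_algebra.
From mathcomp Require Import mathcomp_extra boolp classical_sets cardinality.
From mathcomp Require Import mpoly.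
From mathcomp Require Import zify ring.
From mathcomp Require polyrcf.

Set Implicit Arguments.
Unset Strict Implicit.
Unset Printing Implicit Defensive.

Import Order.TTheory GRing.Theory Num.Theory.
Local Open Scope classical_set_scope.
Local Open Scope ring_scope.

(** For I M <= L <= M, the modules L M^(n-1) / I M^n are the components of a
    graded module over R[x_1, ..., x_r], where the x_i are generators of M: it
    is generated in degree 1, and its components have finite length because
    R / I has. Hence their lengths are given by a polynomial P_L for large n.
    As (L + L') M^(n-1) = L M^(n-1) + L' M^(n-1), the polynomial P_(L+L') is
    eventually bounded by P_L + P_L', so the L with deg P_L <= s - (k+1) are
    closed under sums. This family contains I M and lies in the interval
    [I M, M] of finite length, so it has a largest element.

    The Hilbert-Serre theorem is proved by induction on r through kernel and
    cokernel of y = x_1 on A / B. That graded submodules D of A / B are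
    finitely generated is also shown by induction on r, as for Hilbert's basis
    theorem, but with the y-adic filtration of A and its leading modules: those
    increase with the order and are stable over the other x_i, and the
    induction hypothesis together with the finite lengths makes them
    stabilise. *)

(** * Submodules, strict chains and the length of A / B *)

Section Submodules.
Variables (R : comNzRingType) (V : lmodType R).
Implicit Types A B C D N : set V.

Lemma submoduleP N :
  submodule N <-> N 0 /\ forall a u v, N u -> N v -> N (a *: u + v).
Proof.
split=> -[N0 NL]; split.
- exact: set_mem.
- by move=> a u v Nu Nv; apply: set_mem; apply: NL; exact: mem_set.
- exact: mem_set.
- by move=> a u v /set_mem Nu /set_mem Nv; apply: mem_set; exact: NL.
Qed.

Lemma submodule0 N : submodule N -> N 0.
Proof. by move=> /submoduleP[]. Qed.

Lemma submoduleD N u v : submodule N -> N u -> N v -> N (u + v).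
Proof. by move=> /submoduleP[_ NL] Nu Nv; rewrite -[u]scale1r; exact: NL. Qed.

Lemma submoduleZ N a u : submodule N -> N u -> N (a *: u).
Proof. by move=> /submoduleP[N0 NL] Nu; rewrite -[_ *: _]addr0; exact: NL. Qed.

Lemma submoduleN N u : submodule N -> N u -> N (- u).
Proof. by move=> sN Nu; rewrite -scaleN1r; exact: submoduleZ. Qed.

Lemma submoduleB N u v : submodule N -> N u -> N v -> N (u - v).
Proof. by move=> sN Nu Nv; apply: submoduleD => //; exact: submoduleN. Qed.

Lemma submodule_setT : submodule [set: V].
Proof. by apply/submoduleP. Qed.

Lemma submodule_setI A B : submodule A -> submodule B -> submodule (A `&` B).
Proof.
move=> /submoduleP[A0 AL] /submoduleP[B0 BL]; apply/submoduleP.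
by split=> [//|a u v [Au Bu] [Av Bv]]; split; [exact: AL | exact: BL].
Qed.

Lemma submodule_set0 : submodule [set (0 : V)].
Proof.
by apply/submoduleP; split=> // a u v /= -> ->; rewrite scaler0 addr0.
Qed.

Definition sumset A B : set V := [set u + v | u in A & v in B].

Lemma submodule_sumset A B :
  submodule A -> submodule B -> submodule (sumset A B).
Proof.
move=> sA sB; have [A0 AL] := (submoduleP A).1 sA.
have [B0 BL] := (submoduleP B).1 sB.
apply/submoduleP; split; first by exists 0 => //; exists 0; rewrite ?addr0.
move=> a _ _ [u Au [v Bv <-]] [u' Au' [v' Bv' <-]].
exists (a *: u + u'); first exact: AL.
by exists (a *: v + v'); [exact: BL|rewrite scalerDr addrACA].
Qed.

Lemma sumsetl A B : submodule B -> A `<=` sumset A B.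
Proof. by move=> /submodule0 B0 u Au; exists u => //; exists 0; rewrite ?addr0. Qed.

Lemma sumsetr A B : submodule A -> B `<=` sumset A B.
Proof. by move=> /submodule0 A0 u Bu; exists 0 => //; exists u; rewrite ?add0r. Qed.

Lemma sumset_sub A B N :
  submodule N -> A `<=` N -> B `<=` N -> sumset A B `<=` N.
Proof.
by move=> sN AN BN _ [u /AN Nu [v /BN Nv <-]]; exact: submoduleD.
Qed.

Lemma sumsetS A B A' B' :
  A `<=` A' -> B `<=` B' -> sumset A B `<=` sumset A' B'.
Proof.
by move=> AA BB _ [u /AA Au [v /BB Bv <-]]; exists u => //; exists v.
Qed.

Lemma submodule_mspan (X : set V) : submodule (mspan X).
Proof.
apply/submoduleP; split=> [C [/submoduleP[C0 _] _] //|a u v Xu Xv C CX].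
have [/submoduleP[_ CL] _] := CX.
by apply: CL; [exact: Xu C CX|exact: Xv C CX].
Qed.

Lemma mspan_sub (X N : set V) : submodule N -> X `<=` N -> mspan X `<=` N.
Proof. exact: smallest_sub. Qed.

Lemma sub_mspan (X : set V) : X `<=` mspan X.
Proof. exact: sub_gen_smallest. Qed.

(** An inductive form of [submodule_chain]: the top is fixed and steps are added at the bottom, so
    chains are modified by induction instead of by reindexing functions. *)
Inductive chain A : set V -> nat -> Prop :=
| chain_nil : submodule A -> chain A A 0
| chain_cons B C l :
    submodule B -> B `<` C -> chain A C l -> chain A B l.+1.

Lemma chain_submodule A B l : chain A B l -> submodule A /\ submodule B.
Proof. by elim=> [|? ? ? ? _ _ []]. Qed.

Lemma chain_sub A B l : chain A B l -> B `<=` A.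
Proof.
by elim=> [_ u //|B' C l' _ [BC _] _ CA]; exact: (subset_trans BC).
Qed.

Lemma chainP A B l : chain A B l <-> exists E, submodule_chain A B l E.
Proof.
split.
  elim=> [sA|{}B C {}l sB BC _ [f [f0 fl sf lf]]].
    by exists (fun=> A); split.
  exists (fun i => if i is j.+1 then f j else B); split=> //.
    by case.
  by case=> [_|i]; [rewrite f0|exact: lf].
case=> f; elim: l B f => [|l IH] B f [f0 fl sf lf].
  by rewrite -f0 fl; apply: chain_nil; rewrite -fl; exact: sf.
apply: (@chain_cons _ _ (f 1%N)).
- by rewrite -f0; exact: sf.
- by rewrite -f0; exact: lf.
- by apply: (IH _ (fun i => f i.+1)); split=> // i il; [exact: sf|exact: lf].
Qed.

Lemma module_lengthP A B l : module_length A B l <->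
  chain A B l /\ forall l', chain A B l' -> (l' <= l)%N.
Proof.
split=> -[/chainP Al lM]; split=> //.
  by move=> l' /chainP[C]; exact: lM.
by move=> l' C Cl'; apply: lM; apply/chainP; exists C.
Qed.

Lemma module_length_inj A B l l' :
  module_length A B l -> module_length A B l' -> l = l'.
Proof.
move=> /module_lengthP[cl lM] /module_lengthP[cl' lM'].
by apply/eqP; rewrite eqn_leq lM // lM'.
Qed.

Definition finite_length A B := exists l, module_length A B l.

Lemma finite_length_submodule A B :
  finite_length A B -> [/\ submodule A, submodule B & B `<=` A].
Proof.
move=> [l /module_lengthP[cl _]].
by have [sA sB] := chain_submodule cl; split=> //; exact: chain_sub cl.
Qed.

(** The negated inclusion counts 1 exactly when the step from [B] to [C] is strict, so a weak
    inclusion can be prepended and the count left to arithmetic. *)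
Lemma chain_sub_cons A B C l :
  submodule B -> B `<=` C -> chain A C l ->
  exists2 l', chain A B l' & (l + ~~ `[<C `<=` B>] <= l')%N.
Proof.
move=> sB BC cl; case: asboolP => [CB|nCB].
  by exists l; [have -> : B = C by apply/seteqP|rewrite addn0].
by exists l.+1; [exact: chain_cons cl|rewrite addn1].
Qed.

Lemma bounded_finite_length A B b :
  submodule A -> submodule B -> B `<=` A ->
  (forall l, chain A B l -> (l <= b)%N) -> finite_length A B.
Proof.
move=> sA sB BA bd.
have ex : exists l, `[<chain A B l>].
  have [l cl _] := chain_sub_cons sB BA (chain_nil sA).
  by exists l; exact/asboolP.
have bd' l : `[<chain A B l>] -> (l <= b)%N by move/asboolP/bd.
case: (ex_maxnP ex bd') => l /asboolP cl lM.
by exists l; apply/module_lengthP; split=> // l' /asboolP; exact: lM.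
Qed.

Lemma finite_length_refl A : submodule A -> module_length A A 0.
Proof.
move=> sA; apply/module_lengthP; split; first exact: chain_nil.
suff main B l : chain A B l -> B = A -> (l <= 0)%N by move=> l /main->.
by case=> // {}B C {}l _ [_ nCB] /chain_sub CA BA; case: nCB; rewrite BA.
Qed.

Lemma chain_widen A B A' B' l :
  submodule A' -> submodule B' -> A `<=` A' -> B' `<=` B ->
  chain A B l -> exists2 l', chain A' B' l' & (l <= l')%N.
Proof.
move=> sA' sB' AA' BB' cl.
have {BB'} [l1 c1 l1l] : exists2 l', chain A B' l' & (l <= l')%N.
  have [l' c' /(leq_trans (leq_addr _ _))] := chain_sub_cons sB' BB' cl.
  by exists l'.
have {cl} : exists2 l', chain A' B' l' & (l1 <= l')%N.
  elim: c1 => [sA|B1 C l2 sB BC _ [l' c' l'l]].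
    by have [l' c'] := chain_sub_cons sA AA' (chain_nil sA'); exists l'.
  by exists l'.+1 => //; exact: chain_cons c'.
by move=> [l' c' /(leq_trans l1l)]; exists l'.
Qed.

(* Cutting a chain by C: at each step one of D + C and D n C grows. *)
Lemma chain_cut A B C l :
  submodule C -> C `<=` A -> chain A B l ->
  exists l1 l2, [/\ chain A (sumset B C) l1, chain C (B `&` C) l2
                  & (l <= l1 + l2)%N].
Proof.
move=> sC CA; elim=> [sA|{}B D {}l sB [BD nDB] cD [l1 [l2 [c1 c2 ll]]]].
  exists 0, 0; split=> //.
    have -> : sumset A C = A.
      by apply/seteqP; split; [exact: sumset_sub|exact: sumsetl].
    exact: chain_nil.
  by rewrite setIidr //; exact: chain_nil.
have sBC := submodule_sumset sB sC.
have [l1' c1' l1l] := chain_sub_cons sBC (sumsetS BD (@subset_refl _ C)) c1.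
have [l2' c2' l2l] := chain_sub_cons (submodule_setI sB sC)
  (@setSI _ C _ _ BD) c2.
exists l1', l2'; split=> //.
suff : (0 < ~~ `[<sumset D C `<=` sumset B C>]
  + ~~ `[<D `&` C `<=` B `&` C>])%N by lia.
(* If neither grew, [D] would lie in [B] by the modular law: u = b + c, and c = u - b is in D n C,
   hence in [B]. *)
case: asboolP => // h1; case: asboolP => // h2; exfalso; apply: nDB => u Du.
have sD := (chain_submodule cD).2.
have [b Bb [c Cc ubc]] := h1 _ (sumsetl sC Du).
suff [Bc _] : (B `&` C) c by rewrite -ubc; exact: submoduleD.
apply: h2; split=> //.
have -> : c = u - b by rewrite -ubc [b + c]addrC addrK.
by apply: submoduleB => //; exact: BD.
Qed.

Lemma chain_cat A B C l1 l2 :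
  chain A C l1 -> chain C B l2 -> chain A B (l1 + l2)%N.
Proof.
move=> cA; elim=> [_|{}B D {}l2 sB BD _ IH]; first by rewrite addn0.
by rewrite addnS; exact: chain_cons IH.
Qed.

(** Concatenation attains the sum; [chain_cut] at [C] bounds every chain by it, because B + C = C
    and B n C = B. *)
Lemma module_lengthD A B C l1 l2 :
  module_length A C l1 -> module_length C B l2 ->
  module_length A B (l1 + l2)%N.
Proof.
move=> /module_lengthP[cA bA] /module_lengthP[cC bC]; apply/module_lengthP.
split=> [|l' /(chain_cut (chain_submodule cC).1 (chain_sub cA))].
  exact: chain_cat cA cC.
have BC := chain_sub cC.
have -> : sumset B C = C.
  apply/seteqP; split; first exact: sumset_sub (chain_submodule cC).1 BC _.
  exact: sumsetr (chain_submodule cC).2.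
rewrite (setIidl BC) => -[m1 [m2 [/bA h1 /bC h2 /leq_trans]]].
by apply; exact: leq_add.
Qed.

Lemma finite_length_trans A B C :
  finite_length A C -> finite_length C B -> finite_length A B.
Proof. by move=> [l1 h1] [l2 h2]; exists (l1 + l2)%N; exact: module_lengthD h1 h2. Qed.

Lemma finite_length_sub A B A' B' :
  submodule A' -> submodule B' -> B `<=` B' -> B' `<=` A' -> A' `<=` A ->
  finite_length A B -> finite_length A' B'.
Proof.
move=> sA' sB' BB' BA' AA' fl; have [sA sB _] := finite_length_submodule fl.
have [l /module_lengthP[_ lM]] := fl.
apply: (@bounded_finite_length _ _ l) => // k cA'.
have [k' /lM] := chain_widen sA sB AA' BB' cA'.
by move=> h1 h2; exact: leq_trans h2 h1.
Qed.

Lemma module_length_split A B C l :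
  submodule C -> B `<=` C -> C `<=` A -> module_length A B l ->
  exists l1 l2, [/\ module_length A C l1, module_length C B l2
                  & l = (l1 + l2)%N].
Proof.
move=> sC BC CA Al; have fl : finite_length A B by exists l.
have [sA sB _] := finite_length_submodule fl.
have [l1 h1] := finite_length_sub sA sC BC CA (@subset_refl _ A) fl.
have [l2 h2] := finite_length_sub sC sB (@subset_refl _ B) BC CA fl.
exists l1, l2; split=> //.
by apply: module_length_inj Al _; exact: module_lengthD h1 h2.
Qed.

(** The length of A / C drops strictly when [C] grows, so induction on it is Noetherian induction
    going upwards in the interval. *)
Lemma finite_length_ind A B (P : set V -> Prop) : finite_length A B ->
  (forall C, submodule C -> B `<=` C -> C `<=` A ->
    (forall D, submodule D -> D `<=` A -> C `<` D -> P D) -> P C) ->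
  forall C, submodule C -> B `<=` C -> C `<=` A -> P C.
Proof.
move=> [l Al] IP C sC BC CA.
have [l1 [_ [h1 _ _]]] := module_length_split sC BC CA Al.
elim/ltn_ind: l1 C sC BC CA h1 => l1 IH C sC BC CA h1.
apply: IP => // D sD DA [CD nDC].
have [m1 [m2 [k1 k2 e]]] := module_length_split sD CD DA h1.
apply: (IH m1) => //; last exact: subset_trans CD.
have /module_lengthP[_ m2M] := k2.
suff : (1 <= m2)%N by lia.
by apply: m2M; exact: chain_cons (chain_nil sD).
Qed.

Lemma finite_length_stable A B (D : nat -> set V) : finite_length A B ->
  (forall k, [/\ submodule (D k), B `<=` D k & D k `<=` A]) ->
  (forall k, D k `<=` D k.+1) ->
  exists k0, forall k, (k0 <= k)%N -> D k = D k0.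
Proof.
move=> fl DAB DS.
have Dm i j : (i <= j)%N -> D i `<=` D j.
  elim: j => [|j IH]; first by rewrite leqn0 => /eqP->.
  by rewrite leq_eqVlt => /predU1P[->//|/IH ij]; exact: subset_trans (DS j).
suff main : forall C, submodule C -> B `<=` C -> C `<=` A -> forall k, C = D k ->
    exists k0, forall k, (k0 <= k)%N -> D k = D k0.
  by have [s1 s2 s3] := DAB 0; exact: (main (D 0)).
apply: (finite_length_ind fl) => C sC BC CA IH k CE.
have [?|] := pselect (forall j, (k <= j)%N -> D j = D k); first by exists k.
move=> /existsNP[j /not_implyP[kj Djk]].
have [sD _ DA] := DAB j.
apply: (IH (D j) sD DA _ j) => //; rewrite CE; split; first exact: Dm.
by move=> jk; apply: Djk; apply/seteqP; split=> //; exact: Dm.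
Qed.

End Submodules.

(** * Transport of chains along maps of submodule lattices *)

Section Transfer.
Variables (R : comNzRingType) (V W : lmodType R).

Lemma chain_map (f : set V -> set W) (A B : set V) l :
  (forall C, submodule C -> B `<=` C -> C `<=` A -> submodule (f C)) ->
  (forall C D, submodule C -> submodule D -> B `<=` C -> C `<` D -> D `<=` A ->
    f C `<` f D) ->
  chain A B l -> chain (f A) (f B) l.
Proof.
move=> fs fm cl; elim: {-1}B l / cl (@subset_refl _ B) => [sA BA|C D l sC CD cD IH BC].
  by apply: chain_nil; exact: fs.
have BD := subset_trans BC CD.1; have DA := chain_sub cD.
apply: (chain_cons _ _ (IH BD)).
  by apply: fs => //; exact: subset_trans CD.1 DA.
by apply: fm => //; exact: (chain_submodule cD).2.
Qed.

End Transfer.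

(** * Lengths of images and preimages under a linear map *)

Section Image.
Variables (R : comNzRingType) (V W : lmodType R) (f : V -> W).
Hypothesis f_lin : linear f.

Lemma submodule_image (A : set V) : submodule A -> submodule (f @` A).
Proof.
have f0 : f 0 = 0.
  have := f_lin (-1) 0 0; rewrite scaler0 addr0 scaleN1r => ->; exact: addNr.
move=> /submoduleP[A0 AL]; apply/submoduleP; split; first by exists 0.
move=> a _ _ [u Au <-] [v Av <-].
by exists (a *: u + v); [exact: AL|rewrite f_lin].
Qed.

Lemma submodule_preimage (A : set W) : submodule A -> submodule (f @^-1` A).
Proof.
have f0 : f 0 = 0.
  have := f_lin (-1) 0 0; rewrite scaler0 addr0 scaleN1r => ->; exact: addNr.
move=> /submoduleP[A0 AL]; apply/submoduleP; split; first by rewrite /= f0.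
by move=> a u v Au Av; rewrite /preimage/= f_lin; exact: AL.
Qed.

(* The isomorphism A / (A n f^-1 B) = (f A + B) / B. *)
Lemma module_length_image (A : set V) (B : set W) l :
  submodule A -> submodule B ->
  module_length A (A `&` f @^-1` B) l <->
  module_length (sumset (f @` A) B) B l.
Proof.
move=> sA sB.
have sfA := submodule_image sA.
have sK := submodule_setI sA (submodule_preimage sB).
(* The maps C to f C + B and C to A n f^-1 C match the ends of the two intervals. Both are strictly
   increasing there, so chains of each length pass in both directions. *)
have fK : sumset (f @` (A `&` f @^-1` B)) B = B.
  apply/seteqP; split; last exact: sumsetr (submodule_image sK).
  by apply: sumset_sub => // _ [u [_ Bu] <-].
have fT : A `&` f @^-1` sumset (f @` A) B = A.
  apply: setIidl => u Au; apply: sumsetl => //; exact: imageP.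
have le1 k : chain A (A `&` f @^-1` B) k -> chain (sumset (f @` A) B) B k.
  move=> cl; rewrite -[X in chain _ X]fK.
  apply: (chain_map (f := fun C => sumset (f @` C) B)) cl => [C sC _ _|].
    exact: submodule_sumset (submodule_image sC) sB.
  move=> C D sC sD KC [CD nDC] DA; split.
    by apply: sumsetS => // _ [u Cu <-]; exists u => //; exact: CD.
  move=> h; apply: nDC => u Du.
  have [_ [v Cv <-] [b Bb fvb]] := h _ (sumsetl sB (imageP f Du)).
  have -> : u = 1 *: v + (u - v) by rewrite scale1r addrC subrK.
  apply: submoduleD => //; first by rewrite scale1r.
  apply: KC; split; first by apply: submoduleB => //; apply: DA => //; exact: CD.
  have -> : u - v = (-1) *: v + u by rewrite scaleN1r addrC.
  by rewrite /preimage/= f_lin -fvb scaleN1r addKr.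
have le2 k : chain (sumset (f @` A) B) B k -> chain A (A `&` f @^-1` B) k.
  move=> cl; suff : chain (A `&` f @^-1` sumset (f @` A) B)
    (A `&` f @^-1` B) k by rewrite fT.
  apply: (chain_map (f := fun C => A `&` f @^-1` C)) cl => [C sC _ _|].
    exact: submodule_setI sA (submodule_preimage sC).
  move=> C D sC sD BC [CD nDC] DA; split.
    by move=> v [Av Cv]; split=> //; exact: CD.
  move=> h; apply: nDC => w Dw; have [_ [u Au <-] [b Bb e]] := DA _ Dw.
  rewrite -e; apply: (submoduleD sC _ (BC _ Bb)).
  suff [//] : (A `&` f @^-1` C) u; apply: h; split=> //.
  rewrite /preimage/=; have -> : f u = w - b by rewrite -e addrK.
  by apply: (submoduleB sD Dw); apply: CD; exact: BC.
by split=> /module_lengthP[cl lM]; apply/module_lengthP; split; auto.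
Qed.

End Image.

(** * Finite generation of graded submodules *)

Section GradedModules.
Variables (R : comNzRingType) (S : comAlgType R).
Implicit Types (x y : S) (xs : seq S) (N : set S) (A B D : nat -> set S).

Definition mulset x N : set S := [set x * u | u in N].

(** An iterated sum rather than a span, so that the contribution of the first variable splits off by
    computation. *)
Definition gensum xs N : set S :=
  foldr (fun x => sumset (mulset x N)) [set 0] xs.

Lemma mul_linear x : linear ( *%R x : S -> S).
Proof. by move=> a u v; rewrite mulrDr scalerAr. Qed.

Lemma submodule_mulset x N : submodule N -> submodule (mulset x N).
Proof. by move=> sN; apply: submodule_image => //; exact: mul_linear. Qed.

Lemma submodule_colon x N : submodule N -> submodule [set u | N (x * u)].
Proof. by move=> sN; apply: (submodule_preimage (@mul_linear x)). Qed.

Lemma submodule_gensum xs N : submodule N -> submodule (gensum xs N).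
Proof.
move=> sN; elim: xs => [|x xs IH]; first exact: submodule_set0.
by apply: submodule_sumset => //; exact: submodule_mulset.
Qed.

Lemma gensum_sub xs N N' : submodule N' ->
  (forall x u, x \in xs -> N u -> N' (x * u)) -> gensum xs N `<=` N'.
Proof.
move=> sN'; elim: xs => [|x xs IH] h; first by move=> _ /= ->; exact: submodule0.
apply: sumset_sub => // [_ [u Nu <-]|]; first by apply: h => //; exact: mem_head.
by apply: IH => x' u x'xs; apply: h; rewrite inE x'xs orbT.
Qed.

Lemma mem_gensum xs N x u : submodule N -> x \in xs -> N u ->
  gensum xs N (x * u).
Proof.
move=> sN; elim: xs => // x' xs IH; rewrite inE => /predU1P[<-|xxs] Nu.
  by apply: sumsetl; [exact: submodule_gensum|exact: imageP].
by apply: sumsetr; [exact: submodule_mulset|exact: IH].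
Qed.

Definition stable xs A := forall n x u, x \in xs -> A n u -> A n.+1 (x * u).

(* A / B as a graded module over R[xs] with pieces of finite length, generated
   in degree 0 *)
Definition standard_graded xs A B :=
  [/\ forall n, finite_length (A n) (B n), stable xs A, stable xs B
    & forall n, A n.+1 `<=` sumset (gensum xs (A n)) (B n.+1)].

Lemma stable_cons y xs A : stable (y :: xs) A -> stable xs A.
Proof. by move=> sA n x u xxs; apply: sA; rewrite inE xxs orbT. Qed.

Lemma stable_exp y xs A k n u : stable (y :: xs) A -> A n u -> A (n + k)%N (y ^+ k * u).
Proof.
move=> sA Au; elim: k => [|k IH]; first by rewrite addn0 expr0 mul1r.
by rewrite addnS exprS -mulrA; apply: sA => //; exact: mem_head.
Qed.

(* The shifted module A(-1), with A_{-1} = 0. *)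
Definition twist A n : set S := if n is k.+1 then A k else [set 0].

Lemma submodule_twist A n :
  (forall k, submodule (A k)) -> submodule (twist A n).
Proof. by case: n => [|n]; [move=> _; exact: submodule_set0|exact]. Qed.

Lemma stable_twist xs A : (forall k, submodule (A k)) ->
  stable xs A -> stable xs (twist A).
Proof.
move=> smA sA [|n] x u xxs /=; last exact: sA.
by move=> ->; rewrite mulr0; exact: submodule0.
Qed.

(* The cokernel of y on A / B is A / quot_var y A B. *)
Definition quot_var y A B n := sumset (mulset y (twist A n)) (B n).

Section Step.
Variables (y : S) (xs : seq S) (A B : nat -> set S).
Hypothesis gAB : standard_graded (y :: xs) A B.

Let smA n : submodule (A n).
Proof. by have [fl _ _ _] := gAB; have [] := finite_length_submodule (fl n). Qed.

Let smB n : submodule (B n).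
Proof. by have [fl _ _ _] := gAB; have [] := finite_length_submodule (fl n). Qed.

Let subBA n : B n `<=` A n.
Proof. by have [fl _ _ _] := gAB; have [] := finite_length_submodule (fl n). Qed.

Let stA : stable (y :: xs) A. Proof. by case: gAB. Qed.
Let stB : stable (y :: xs) B. Proof. by case: gAB. Qed.
Let stA' : stable xs A := stable_cons stA.
Let stB' : stable xs B := stable_cons stB.
Let smT n : submodule (twist A n). Proof. exact: submodule_twist. Qed.

Let mul_twist n u : twist A n u -> A n (y * u).
Proof.
case: n => [|n] /=; first by move=> ->; rewrite mulr0; exact: submodule0.
by move=> Au; apply: stA => //; exact: mem_head.
Qed.

Lemma submodule_quot_var n : submodule (quot_var y A B n).
Proof. by apply: submodule_sumset => //; exact: submodule_mulset. Qed.

Lemma quot_var_sub n : quot_var y A B n `<=` A n.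
Proof. by apply: sumset_sub => // _ [u Tu <-]; exact: mul_twist. Qed.

Lemma sub_quot_var n : B n `<=` quot_var y A B n.
Proof. by apply: sumsetr; exact: submodule_mulset. Qed.

(** Multiples of [y] vanish in the cokernel, so [xs] alone generates it. This removes one variable
    in both inductions. *)
Lemma standard_graded_quot : standard_graded xs A (quot_var y A B).
Proof.
have [fl _ _ gA] := gAB; split=> [n||n x u xxs [_ [v Tv <-] [b Bb <-]]|n u Au].
- by apply: finite_length_sub (fl n); [exact: smA|exact: submodule_quot_var
    |exact: sub_quot_var|exact: quot_var_sub|].
- exact: stA'.
- rewrite mulrDr mulrCA; exists (y * (x * v)).
    by exists (x * v) => //; apply: (@stable_twist xs _ _ _ n x) => //; exact: stA'.
  by exists (x * b) => //; move: xxs Bb; exact: stB'.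
- have [_ [_ [a Aa <-] [g Gg <-]] [b Bb <-]] := gA n u Au.
  rewrite -addrA addrCA; exists g => //; exists (y * a + b) => //.
  by exists (y * a) => //; [exists a|exists b].
Qed.

Variable D : nat -> set S.
Hypotheses (smD : forall n, submodule (D n)) (subBD : forall n, B n `<=` D n).
Hypotheses (subDA : forall n, D n `<=` A n) (stD : stable (y :: xs) D).
Let stD' : stable xs D := stable_cons stD.

(* The a in A_n such that y^k a is the leading term, for the y-adic
   filtration, of an element of D_{n+k}. *)
Definition lead_mod k n : set S :=
  A n `&` [set a | sumset (D (n + k)%N) (mulset (y ^+ k.+1) (twist A n))
                     (y ^+ k * a)].

Let mul_exprS k u : y ^+ k.+1 * u = y * (y ^+ k * u).
Proof. by rewrite exprS mulrA. Qed.

Lemma submodule_lead_mod k n : submodule (lead_mod k n).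
Proof.
apply: submodule_setI => //; apply: submodule_colon.
by apply: submodule_sumset => //; exact: submodule_mulset.
Qed.

(** Together with [stable_lead_mod], this makes [lead_mod k] a graded submodule over [xs] of the
    cokernel of [y], where the induction hypothesis applies. *)
Lemma quot_var_lead_mod k n : quot_var y A B n `<=` lead_mod k n.
Proof.
move=> u Qu; split; first exact: quot_var_sub.
have [_ [v Tv <-] [b Bb <-]] := Qu.
rewrite /= mulrDr addrC mulrA -exprSr; exists (y ^+ k * b).
  by apply: subBD; exact: stable_exp stB _.
by exists (y ^+ k.+1 * v) => //; exists v.
Qed.

Lemma lead_modS k n : lead_mod k n `<=` lead_mod k.+1 n.
Proof.
move=> u [Au [d Dd [_ [v Tv <-] e]]]; split=> //=.
rewrite mul_exprS -e mulrDr; exists (y * d).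
  by rewrite addnS; apply: stD => //; exact: mem_head.
by exists (y * (y ^+ k.+1 * v)) => //; exists v; rewrite // mul_exprS.
Qed.

Lemma lead_mod_mono k k' n : (k <= k')%N -> lead_mod k n `<=` lead_mod k' n.
Proof.
elim: k' => [|k' IH]; first by rewrite leqn0 => /eqP->.
by rewrite leq_eqVlt => /predU1P[->//|/IH h]; exact: subset_trans (@lead_modS _ _).
Qed.

Lemma stable_lead_mod k : stable xs (lead_mod k).
Proof.
move=> n x u xxs [Au [d Dd [_ [v Tv <-] e]]]; split.
  exact: stA'.
rewrite /= mulrCA -e mulrDr; exists (x * d); first exact: stD'.
exists (x * (y ^+ k.+1 * v)) => //; exists (x * v); last by rewrite mulrCA.
by apply: (@stable_twist xs _ _ _ n x) => //; exact: stA'.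
Qed.

Definition lead_lim n : set S := \bigcup_k lead_mod k n.

Lemma submodule_lead_lim n : submodule (lead_lim n).
Proof.
apply/submoduleP; split; first by exists 0 => //; exact: submodule0 (submodule_lead_mod _ _).
move=> a u v [k _ Lu] [k' _ Lv]; exists (maxn k k') => //.
have sL := submodule_lead_mod (maxn k k') n.
apply: submoduleD => //; first apply: submoduleZ => //.
  by apply: lead_mod_mono Lu; exact: leq_maxl.
by apply: lead_mod_mono Lv; exact: leq_maxr.
Qed.

Lemma stable_lead_lim : stable xs lead_lim.
Proof. by move=> n x u xxs [k _ Lu]; exists k => //; exact: stable_lead_mod. Qed.

Lemma eventually_bounded (P : nat -> nat -> Prop) K :
  (forall k, exists n1, forall n, (n1 <= n)%N -> P k n) ->
  exists n1, forall k n, (k <= K)%N -> (n1 <= n)%N -> P k n.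
Proof.
move=> h; elim: K => [|K [N1 IH]].
  by have [N1 h1] := h 0; exists N1 => k n; rewrite leqn0 => /eqP->; exact: h1.
have [N2 h2] := h K.+1; exists (maxn N1 N2) => k n.
rewrite geq_max leq_eqVlt => /predU1P[->|kK] /andP[n1 n2]; first exact: h2.
exact: IH.
Qed.

Hypothesis IH : forall E, (forall n, submodule (E n)) ->
  (forall n, quot_var y A B n `<=` E n) -> (forall n, E n `<=` A n) ->
  stable xs E -> exists n1, forall n, (n1 <= n)%N ->
    E n.+1 `<=` sumset (gensum xs (E n)) (quot_var y A B n.+1).

(** In degrees up to some [n1], finite length makes the increasing [lead_mod k n] stop at a common
    [k0]. Beyond [n1] the limit is generated over [xs] from the degree below, and [lead_mod k0] is
    stable under [xs]. *)
Lemma lead_lim_stable : exists k0, forall n, lead_lim n `<=` lead_mod k0 n.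
Proof.
have [n|n|n u [k _ []] //||n1 h] := IH (E := lead_lim).
- exact: submodule_lead_lim.
- by move=> u Qu; exists 0 => //; exact: quot_var_lead_mod.
- exact: stable_lead_lim.
(* The roles are exchanged here: the degree is the bounded index and the order [k] is taken
   large. *)
have [n|k0 hk0] := @eventually_bounded (fun n k => lead_lim n `<=` lead_mod k n) n1.
  have [fl _ _ _] := standard_graded_quot.
  have [k|k|k0 h0] := @finite_length_stable _ _ _ _ (lead_mod^~ n) (fl n).
  - split; [exact: submodule_lead_mod|exact: quot_var_lead_mod|by move=> u []].
  - exact: lead_modS.
  exists k0 => k k0k u [j _ Lu]; apply: (lead_mod_mono k0k).
  rewrite -(h0 (maxn j k0)) ?leq_maxr //.
  by apply: lead_mod_mono Lu; exact: leq_maxl.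
exists k0; elim=> [|n IHn]; first exact: hk0.
have [nn1|n1n] := leqP n.+1 n1; first exact: hk0.
apply: (subset_trans (h n n1n)); apply: sumset_sub.
- exact: submodule_lead_mod.
- apply: gensum_sub; first exact: submodule_lead_mod.
  by move=> x u xxs /IHn; exact: stable_lead_mod.
- exact: quot_var_lead_mod.
Qed.

(** An element of [D m.+1] is corrected by the generated part [G] until the remainder is a multiple
    of ever higher powers of [y]; at last it vanishes for degree reasons. *)
Lemma graded_noetherian_step : exists n1, forall n, (n1 <= n)%N ->
  D n.+1 `<=` sumset (gensum (y :: xs) (D n)) (B n.+1).
Proof.
have [k0 hk0] := lead_lim_stable.
have [k|N1 hN1] := @eventually_bounded (fun k n => lead_mod k n.+1 `<=`
  sumset (gensum xs (lead_mod k n)) (quot_var y A B n.+1)) k0.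
  apply: IH => [n|n|n u []//|]; first exact: submodule_lead_mod.
    exact: quot_var_lead_mod.
  exact: stable_lead_mod.
(* With n + k = m + 1 and k <= k0, this bound leaves n - 1 >= N1, the range where [lead_mod k] is
   generated over [xs]. *)
exists (N1 + k0)%N => m mge; set G := sumset _ _.
have sG : submodule G.
  by apply: submodule_sumset => //; exact: submodule_gensum.
have GD : G `<=` D m.+1.
  apply: sumset_sub => //; apply: gensum_sub => // x u xxs; exact: stD.
have G_mul x u : x \in y :: xs -> D m u -> G (x * u).
  by move=> xxs Du; apply: sumsetl => //; exact: mem_gensum.
have G_B : B m.+1 `<=` G by apply: sumsetr; exact: submodule_gensum.
(* A leading term of order [k] agrees with an element of [G] up to order k + 1. *)
have step n k a : (n + k = m.+1)%N -> lead_mod k n a ->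
    sumset G (mulset (y ^+ k.+1) (twist A n)) (y ^+ k * a).
  move=> nk La; have sGT : submodule (sumset G (mulset (y ^+ k.+1) (twist A n))).
    by apply: submodule_sumset => //; exact: submodule_mulset.
  (* Low order: modulo [quot_var], the leading coefficient comes from degree n - 1 by multiplication
     with [xs]. *)
  have [kk0|] := leqP k k0.
    case: n nk La sGT => [|n] nk La sGT; first by lia.
    have nm : (n + k = m)%N by lia.
    have N1n : (N1 <= n)%N by lia.
    pose N : set S := [set u |
      sumset G (mulset (y ^+ k.+1) (twist A n.+1)) (y ^+ k * u)].
    have sN : submodule N by exact: submodule_colon.
    suff h : sumset (gensum xs (lead_mod k n)) (quot_var y A B n.+1) `<=` N.
      by apply: h; exact: hN1 La.
    apply: sumset_sub => //.
    - apply: gensum_sub => // x u xxs [Au [d Dd [_ [v Tv <-] e]]].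
      rewrite /N/= mulrCA -e mulrDr; exists (x * d).
        by apply: G_mul; [rewrite inE xxs orbT|rewrite -nm].
      exists (x * (y ^+ k.+1 * v)) => //; exists (x * v); last by rewrite mulrCA.
      suff : twist A n.+1 (x * v) by [].
      by apply: (@stable_twist xs _ _ _ n x) => //; exact: stA'.
    - move=> _ [_ [v Tv <-] [b Bb <-]].
      rewrite /N/= mulrDr addrC mulrA -exprSr; exists (y ^+ k * b).
        by apply: G_B; rewrite -nk; exact: stable_exp stB _.
      by exists (y ^+ k.+1 * v) => //; exists v.
  (* High order: by stabilisation [a] is already a leading coefficient of order one less, so the
     element of [G] is [y] times an element of [D m]. *)
  case: k nk La sGT => // k nk La sGT k0k.
  have nm : (n + k = m)%N by lia.
  have La' : lead_lim n a by exists k.+1.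
  have [_ [d Dd [_ [v Tv <-] e]]] :=
    @lead_mod_mono k0 k n k0k a (hk0 n a La').
  rewrite mul_exprS -e mulrDr; exists (y * d).
    by apply: G_mul; [exact: mem_head|rewrite -nm].
  by exists (y * (y ^+ k.+1 * v)) => //; exists v; rewrite // mul_exprS.
have sub_step k n u : (n + k = m.+1)%N -> D m.+1 u ->
    sumset G (mulset (y ^+ k) (A n)) u ->
    sumset G (mulset (y ^+ k.+1) (twist A n)) u.
  move=> nk Du [g Gg [_ [a Aa <-] e]].
  have La : lead_mod k n a.
    split=> //=; apply: sumsetl; first exact: submodule_mulset.
    have -> : y ^+ k * a = u - g by rewrite -e addrC addKr.
    by rewrite nk; apply: submoduleB => //; exact: GD.
  have [g' Gg' [_ [v Tv <-] e']] := step n k a nk La.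
  exists (g + g'); first exact: submoduleD.
  by exists (y ^+ k.+1 * v); [exists v|rewrite -addrA e'].
move=> u Du.
have main k : (k <= m.+1)%N -> sumset G (mulset (y ^+ k) (A (m.+1 - k)%N)) u.
  elim: k => [_|k IHk km]; first by exists 0; [exact: submodule0|exists u;
    [exists u; [rewrite subn0; exact: subDA|rewrite expr0 mul1r]|rewrite add0r]].
  have := sub_step k _ u (subnK (ltnW km)) Du (IHk (ltnW km)).
  by rewrite subSn //= subSS.
(* Here the degree of the coefficient is 0 and [twist A 0] is zero, so [u] itself is in [G]. *)
have := sub_step m.+1 _ u (subnK (leqnn _)) Du (main _ (leqnn _)).
rewrite subnn => -[g Gg [_ [_ -> <-] <-]].
by rewrite mulr0 addr0.
Qed.

End Step.

(** As the components have finite length, generation from the preceding degree for large n amounts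
    to finite generation of D / B. *)
Theorem graded_noetherian xs A B D : standard_graded xs A B ->
  (forall n, submodule (D n)) -> (forall n, B n `<=` D n) ->
  (forall n, D n `<=` A n) -> stable xs D ->
  exists n1, forall n, (n1 <= n)%N ->
    D n.+1 `<=` sumset (gensum xs (D n)) (B n.+1).
Proof.
elim: xs A B D => [|y xs IH] A B D gAB smD BD DA stD.
  have [fl _ _ gA] := gAB; exists 0 => n _ u /DA/gA [_ -> [b Bb <-]].
  by exists 0 => //; exists b.
apply: (graded_noetherian_step gAB) => // E smE QE EA stE.
by apply: IH stE => //; exact: standard_graded_quot gAB.
Qed.

End GradedModules.

(** * Polynomial functions: summation and comparison of degrees *)

Section PolynomialFunctions.
Implicit Types (P Q : {poly rat}).

(** (X+1)^(k+1) - X^(k+1) is (k+1) X^k plus lower powers, so the monomials are reached by strong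
    induction on the exponent. *)
Lemma antidifference Q : exists P, P \Po ('X + 1) - P = Q.
Proof.
pose anti Q := exists P, P \Po ('X + 1) - P = Q.
have antiD Q1 Q2 : anti Q1 -> anti Q2 -> anti (Q1 + Q2).
  by move=> [P1 <-] [P2 <-]; exists (P1 + P2); rewrite comp_polyD opprD addrACA.
have antiZ c Q1 : anti Q1 -> anti (c *: Q1).
  by move=> [P1 <-]; exists (c *: P1); rewrite comp_polyZ scalerBr.
have anti_sum n (F : 'I_n -> {poly rat}) :
    (forall i, anti (F i)) -> anti (\sum_i F i).
  move=> aF; elim/big_ind: _ => //.
  by exists 0; rewrite comp_poly0 subr0.
suff antiX k : anti 'X^k.
  rewrite -[Q]coefK poly_def; apply: anti_sum => i; apply: antiZ; exact: antiX.
elim/ltn_ind: k => k IH.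
have k1 : k.+1%:R != 0 :> rat by rewrite pnatr_eq0.
have XkE : 'X^k = k.+1%:R^-1 *: ((('X + 1) ^+ k.+1 - 'X^(k.+1))
    + (-1) *: (\sum_(i < k) ('C(k.+1, i)%:R *: 'X^i))) :> {poly rat}.
  rewrite exprD1n !big_ord_recr /= binn binSn mulr1n addrK.
  under eq_bigr do rewrite -scaler_nat.
  by rewrite scaleN1r addrAC subrr add0r -scaler_nat scalerA mulVf // scale1r.
rewrite XkE; apply/antiZ/antiD.
  by exists 'X^(k.+1); rewrite comp_Xn_poly.
by apply/antiZ/anti_sum => i; apply/antiZ/IH.
Qed.

(** The recurrence f(n+1) - f(n) = g(n) - h(n), written with sums to stay in [nat], makes [f] an
    antidifference of P - Q up to a constant. *)
Lemma poly_of_difference (f g : nat -> nat) (h : nat -> nat) P Q n0 :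
  (forall n, (n0 <= n)%N -> f n.+1 + h n = g n + f n)%N ->
  (forall n, (n0 <= n)%N -> (g n)%:R = P.[n%:R]) ->
  (forall n, (n0 <= n)%N -> (h n)%:R = Q.[n%:R]) ->
  exists T : {poly rat}, forall n, (n0 <= n)%N -> (f n)%:R = T.[n%:R].
Proof.
move=> fgh gP hQ; have [T TE] := antidifference (P - Q).
(* The constant makes both sides agree at [n0], where the induction starts. *)
exists (T + ((f n0)%:R - T.[n0%:R])%:P) => n.
rewrite hornerD hornerC.
elim: n => [|n IH]; first by rewrite leqn0 => /eqP->; rewrite addrC subrK.
rewrite leq_eqVlt => /predU1P[<-|n0n]; first by rewrite addrC subrK.
have TS : T.[n.+1%:R] = T.[n%:R] + (P.[n%:R] - Q.[n%:R]).
  have : (T \Po ('X + 1) - T).[n%:R] = (P - Q).[n%:R] by rewrite TE.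
  rewrite !hornerD !hornerN horner_comp hornerD hornerX hornerE natr1 => <-.
  by rewrite addrC subrK.
have /(congr1 (fun k => k%:R : rat)) := fgh n n0n.
rewrite !natrD gP // hQ // IH // TS => /(canRL (addrK _)) ->.
ring.
Qed.

Lemma horner_eventually_gt0 P : 0 < lead_coef P ->
  exists n0, forall n, (n0 <= n)%N -> 0 < P.[n%:R].
Proof.
move=> lP; have [x hx] := polyrcf.poly_pinfty_gt_lc lP.
exists (Num.bound `|x|) => n xn; apply: (lt_le_trans lP); apply: hx.
apply: le_trans (ler_norm x) _; apply: ltW.
apply: lt_le_trans (archi_boundP (normr_ge0 x)) _.
by rewrite ler_nat.
Qed.

(** If [P] had the larger size, its leading coefficient would be positive, as P >= 0 eventually, and
    would also lead P - Q, against P <= Q. *)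
Lemma size_eventually_le P Q n0 :
  (forall n, (n0 <= n)%N -> 0 <= P.[n%:R] <= Q.[n%:R]) ->
  (size P <= size Q)%N.
Proof.
move=> PQ; have [//|QP] := leqP; exfalso.
have P0 : P != 0 by rewrite -size_poly_gt0 (leq_ltn_trans _ QP).
have lP : 0 < lead_coef P.
  rewrite lt_def lead_coef_eq0 P0 leNgt; apply/negP => lP.
  have [|n1 h1] := @horner_eventually_gt0 (- P); first by rewrite lead_coefN oppr_gt0.
  have := h1 _ (leq_maxr n0 n1); rewrite hornerN oppr_gt0.
  by have /andP[/le_lt_trans h _] := PQ _ (leq_maxl n0 n1) => /h; rewrite ltxx.
have [|n1 h1] := @horner_eventually_gt0 (P - Q).
  by rewrite lead_coefDl // size_polyN.
have := h1 _ (leq_maxr n0 n1); rewrite hornerD hornerN subr_gt0.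
by have /andP[_ /le_lt_trans h] := PQ _ (leq_maxl n0 n1) => /h; rewrite ltxx.
Qed.

End PolynomialFunctions.

(** * The Hilbert-Serre theorem *)

Section HilbertSerre.
Variables (R : comNzRingType) (S : comAlgType R).
Implicit Types (xs : seq S) (A B : nat -> set S).

(** Exactness of kernel and cokernel for multiplication by [y] from A_n / B_n to A_(n+1) / B_(n+1):
    both l - c and k - h are the length of its image. *)
Lemma length_colon (y : S) xs A B n k l c : standard_graded (y :: xs) A B ->
  module_length (A n.+1) (B n.+1) l -> module_length (A n) (B n) k ->
  module_length (A n.+1) (quot_var y A B n.+1) c ->
  exists2 h, module_length (A n `&` [set u | B n.+1 (y * u)]) (B n) h
           & (l + h = c + k)%N.
Proof.
move=> gAB lA kA cA; have [fl stA stB _] := gAB.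
have [sA sB BA] := finite_length_submodule (fl n).
have [sA1 sB1 BA1] := finite_length_submodule (fl n.+1).
have sK : submodule (A n `&` [set u | B n.+1 (y * u)]).
  by apply: submodule_setI => //; exact: submodule_colon.
have BK : B n `<=` A n `&` [set u | B n.+1 (y * u)].
  by move=> u Bu; split; [exact: BA|exact: stB (mem_head _ _) Bu].
have [k1 [h [k1A hA ->]]] := module_length_split sK BK (@subIsetl _ _ _) kA.
have [c' [k1' [c'A k1'A ->]]] := module_length_split
  (submodule_quot_var gAB n.+1) (sub_quot_var gAB (n:=n.+1))
  (quot_var_sub gAB (n:=n.+1)) lA.
exists h => //; rewrite (module_length_inj c'A cA).
have := (module_length_image (@mul_linear _ _ y) k1 sA sB1).1 k1A.
by move=> /(module_length_inj k1'A) ->; lia.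
Qed.

Theorem hilbert_serre xs A B : standard_graded xs A B ->
  exists P : {poly rat}, exists n0, forall n, (n0 <= n)%N ->
    exists l, module_length (A n) (B n) l /\ l%:R = P.[n%:R].
Proof.
elim: xs A B => [|y xs IH] A B gAB; have [fl stA stB gA] := gAB.
  (* With no variables, the components vanish from degree 1 on. *)
  exists 0, 1%N; case=> // n _; exists 0; split; last by rewrite horner0.
  have [_ sB BA] := finite_length_submodule (fl n.+1).
  have -> : A n.+1 = B n.+1.
    apply/seteqP; split=> // u /gA [_ -> [b Bb <-]]; by rewrite add0r.
  exact: finite_length_refl.
have sA n : submodule (A n) by have [] := finite_length_submodule (fl n).
have sB n : submodule (B n) by have [] := finite_length_submodule (fl n).
have BA n : B n `<=` A n by have [] := finite_length_submodule (fl n).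
pose K n := A n `&` [set u | B n.+1 (y * u)].
have sK n : submodule (K n).
  by apply: submodule_setI => //; exact: submodule_colon.
have BK n : B n `<=` K n.
  by move=> u Bu; split; [exact: BA|exact: stB (mem_head _ _) Bu].
have stK : stable (y :: xs) K.
  move=> n x u xxs [Au Bu]; split; first exact: stA.
  by rewrite /= mulrCA; exact: stB.
have [n1 gK] := graded_noetherian gAB sK BK (fun n => @subIsetl _ _ _) stK.
have /IH[P [n2 hP]] := standard_graded_quot gAB.
(* The kernel is killed by [y], hence generated over [xs], but only from degree [n1] on. The shift
   puts its generators in degree 0, as [standard_graded] requires. *)
have /IH[Q [n3 hQ]] : standard_graded xs (fun n => K (n + n1)%N) (fun n => B (n + n1)%N).
  split=> [n|||n].
  - exact: finite_length_sub (sK _) (sB _) (@subset_refl _ _) (BK _) (@subIsetl _ _ _) (fl _).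

  - by move=> n x u xxs; apply: stK; rewrite inE xxs orbT.
  - by move=> n x u xxs; apply: stB; rewrite inE xxs orbT.
  - rewrite addSn => u /(gK _ (leq_addl n n1)).
    apply: sumset_sub => [||]; last by apply: sumsetr; exact: submodule_gensum.
      by apply: submodule_sumset => //; exact: submodule_gensum.
    move=> _ [_ [v [Av Bv] <-] [w Kw <-]].
    by exists w => //; exists (y * v) => //; rewrite addrC.
have /choice[f fP] : forall n, exists l, module_length (A n) (B n) l by [].
have /choice[g gP] : forall n, exists l, module_length (A n.+1) (quot_var y A B n.+1) l.
  by move=> n; have [flQ _ _ _] := standard_graded_quot gAB; exact: flQ.
have /choice[h hhP] : forall n, exists l, module_length (K n) (B n) l.
  by move=> n; have [c] := length_colon gAB (fP n.+1) (fP n) (gP n); exists c.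
pose n0 := maxn n2 (n1 + n3).
(* The cokernel enters in degree n + 1, and [Q] belongs to the kernel shifted by [n1]; the
   compositions account for this. *)
have [n n0n|n n0n|n n0n|T hT] := @poly_of_difference f g h (P \Po ('X + 1))
    (Q \Po ('X - n1%:R%:P)) n0.
- have [c hc <-] := length_colon gAB (fP n.+1) (fP n) (gP n).
  by rewrite (module_length_inj (hhP n) hc).
- have [|l [lQ]] := hP n.+1; first by lia.
  by rewrite horner_comp !hornerE natr1 (module_length_inj (gP n) lQ).
- have [|l [lQ]] := hQ (n - n1)%N; first by lia.
  rewrite subnK in lQ; last by lia.
  rewrite horner_comp !hornerE natrB; last by lia.
  by rewrite (module_length_inj (hhP n) lQ).
by exists T, n0 => n n0n; exists (f n); split; [exact: fP|exact: hT].
Qed.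

End HilbertSerre.

(** * Finite length of N / I N *)

Section IdealQuotients.
Variables (R : comNzRingType) (V : lmodType R).
Implicit Types (I : set R) (N : set V) (G : seq V).

Lemma scale_linear (g : V) : linear (fun r : R^o => r *: g).
Proof. by move=> a u v; rewrite scalerDl scalerA. Qed.

(** (R g + N) / N is R / (N : g), a quotient of R / I. *)
Lemma finite_length_cyclic I (g : V) N :
  @finite_length R R^o setT I -> submodule N -> (forall a, I a -> N (a *: g)) ->
  finite_length (sumset [set r *: g | r in [set: R]] N) N.
Proof.
move=> flI sN IN; have [_ sI _] := finite_length_submodule flI.
have [l] : @finite_length R R^o setT (setT `&` [set r : R^o | N (r *: g)]).
  apply: finite_length_sub flI => //; [exact: submodule_setT| |].
    rewrite setTI; exact: (submodule_preimage (scale_linear g)).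
  by rewrite setTI => a /IN.
move/(module_length_image (scale_linear g) _ (@submodule_setT R R^o) sN) => h.
by exists l.
Qed.

Lemma submodule_ideal_mul I N : submodule (ideal_mul I N).
Proof. exact: submodule_mspan. Qed.

Lemma mem_ideal_mul I N a x : I a -> N x -> ideal_mul I N (a *: x).
Proof. by move=> Ia Nx; apply: sub_mspan; exists a => //; exists x. Qed.

Lemma ideal_mul_sub I N N' : submodule N' ->
  (forall a x, I a -> N x -> N' (a *: x)) -> ideal_mul I N `<=` N'.
Proof.
by move=> sN' h; apply: mspan_sub => // _ [a Ia [x Nx <-]]; exact: h.
Qed.

(** The generators of [N] are added to I N one at a time; each successive quotient is cyclic and
    killed by [I]. *)
Lemma finite_length_ideal_mul I N :
  @finite_length R R^o setT I -> fin_gen N -> finite_length N (ideal_mul I N).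
Proof.
move=> flI [G NG].
have sN : submodule N by rewrite NG; exact: submodule_mspan.
set B := ideal_mul I N; have sB : submodule B by exact: submodule_ideal_mul.
have BN : B `<=` N.
  by apply: ideal_mul_sub => // a x _; exact: submoduleZ.
have GN g : g \in G -> N g by rewrite NG => gG; apply: sub_mspan.
suff [C [sC flC GC]] : exists C : set V,
    [/\ submodule C, finite_length C B & forall g, g \in G -> C g].
  have [_ _ BC] := finite_length_submodule flC.
  apply: finite_length_sub flC => //.
  by rewrite NG; apply: mspan_sub => // g /GC.
elim: G {NG} GN => [|g G IH] GN.
  by exists B; split=> //; exists 0; exact: finite_length_refl.
have [|C [sC flC GC]] := IH.
  by move=> x xG; apply: GN; rewrite inE xG orbT.
have [_ _ BC] := finite_length_submodule flC.
have sg : submodule [set r *: g | r in [set: R]].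
  exact: (submodule_image (scale_linear g) (@submodule_setT R R^o)).
exists (sumset [set r *: g | r in [set: R]] C); split.
- exact: submodule_sumset.
- apply: finite_length_trans flC; apply: (finite_length_cyclic flI) => // a Ia.
  by apply: BC; apply: mem_ideal_mul => //; apply: GN; exact: mem_head.
- move=> x; rewrite inE => /predU1P[->|/GC Cx].
    by apply: sumsetl => //; exists 1; rewrite ?scale1r.
  by apply: sumsetr.
Qed.

End IdealQuotients.

(** * Finite colength of the Fitting ideal *)

Section Fitting.
Variables (R : comNzRingType) (p : nat).
Hypothesis R_noeth : noetherian R.
Implicit Types (M : set 'rV[R]_p).

Lemma noetherian_fin_gen (I : set R) : @submodule R R^o I -> @fin_gen R R^o I.
Proof.
move=> sI; apply: R_noeth; split=> //.
- exact: (@submodule0 R R^o).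
- by move=> x y; exact: (@submoduleD R R^o).
- by move=> a x _; exact: (@submoduleZ R R^o).
Qed.

(** A further factor J adds the quotient P / J P, of finite length because the ideal P is finitely
    generated. *)
Lemma finite_length_ideal_prod (T : Type) (s : seq T) (J : T -> set R) :
  (forall i, @finite_length R R^o setT (J i)) ->
  @finite_length R R^o setT
    (foldr (fun i => @ideal_mul R R^o (J i)) setT s).
Proof.
move=> flJ; elim: s => [|i s IH] /=.
  by exists 0; apply: finite_length_refl; exact: submodule_setT.
apply: finite_length_trans (IH) _; apply: finite_length_ideal_mul (flJ i) _.
by apply: noetherian_fin_gen; have [] := finite_length_submodule IH.
Qed.

(** The annihilator of the i-th basis vector in R^p / M. *)
Definition coord_ideal M i : set R := [set a | M (a *: delta_mx 0 i)].

Lemma finite_length_coord_ideal M i : finite_length setT M ->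
  @finite_length R R^o setT (coord_ideal M i).
Proof.
move=> flM; have [_ sM _] := finite_length_submodule flM.
have sg := submodule_image (scale_linear (delta_mx 0 i : 'rV[R]_p))
  (@submodule_setT R R^o).
have [l] : finite_length (sumset [set (r : R^o) *: delta_mx 0 i | r in [set: R^o]] M) M.
  apply: finite_length_sub flM => //; first exact: submodule_sumset.
  exact: sumsetr.
move/(module_length_image (scale_linear (delta_mx 0 i : 'rV[R]_p)) _
  (@submodule_setT R R^o) sM); rewrite setTI => h.
by exists l.
Qed.

Lemma submodule_fitt0 M : @submodule R R^o (fitt0 M).
Proof. exact: submodule_mspan. Qed.

(** Reduces products of ideals to products of elements, one from each. The factor [c] collects the
    elements already chosen and starts at 1. *)
Lemma coord_ideal_prod_sub M (s : seq 'I_p) c : uniq s ->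
  (forall b : 'I_p -> R, (forall i, i \in s -> coord_ideal M i (b i)) ->
     fitt0 M (c * \prod_(i <- s) b i)) ->
  forall r, foldr (fun i => @ideal_mul R R^o (coord_ideal M i)) setT s r ->
    fitt0 M (c * r).
Proof.
elim: s c => [|i s IH] c /=.
  move=> _ h r _; rewrite mulrC; apply: (@submoduleZ R R^o) (submodule_fitt0 M) _.
  by have := h (fun=> 0); rewrite big_nil mulr1; apply.
case/andP=> nis us h r Pr.
have sN := submodule_preimage (@mul_linear R R^o c) (submodule_fitt0 M).
apply: (ideal_mul_sub sN _ Pr) => a x Ja Px.
rewrite /preimage/= /GRing.scale /= mulrA; apply: IH => // b bJ.
(* By [uniq], i does not occur in the tail, so setting the value there to [a] leaves the rest of the
   product unchanged. *)
have := h (fun j => if j == i then a else b j).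
rewrite big_cons eqxx mulrA; rewrite (eq_big_seq b) => [|j js].
  apply=> j; rewrite inE; case: eqVneq => [-> //|_ /=]; exact: bJ.
by case: eqVneq js nis => // -> ->.
Qed.

(** A diagonal matrix with entries in the [coord_ideal M i] has its rows in [M], so the Fitting
    ideal contains the product of these ideals, which has finite colength. *)
Lemma finite_length_fitt0 M : finite_length setT M ->
  @finite_length R R^o setT (fitt0 M).
Proof.
move=> flM.
apply: finite_length_sub (finite_length_ideal_prod (index_enum 'I_p)
  (fun i => finite_length_coord_ideal i flM)).
- exact: submodule_setT.
- exact: submodule_fitt0.
- move=> r Pr; rewrite -[r]mul1r.
  apply: coord_ideal_prod_sub Pr => [|b bJ]; first exact: index_enum_uniq.
  apply: sub_mspan; exists (diag_mx (\row_i b i)) => [i /=|].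
    by rewrite row_diag_mx mxE; apply: bJ; rewrite mem_index_enum.
  by rewrite det_diag mul1r; apply: eq_bigr => i _; rewrite mxE.
- by [].
- by [].
Qed.

End Fitting.

(** * Powers of M in the Rees algebra, and the graded module of L *)

Section ReesPowers.
Variables (R : comNzRingType) (p : nat) (X : seq 'rV[R]_p).
Let M : set 'rV[R]_p := mspan [set` X].
Let xs : seq {mpoly R[p]} := [seq linform v | v <- X].
Implicit Types (L N : set 'rV[R]_p) (I : set R).

Lemma linform_linear : linear (@linform R p).
Proof.
move=> a u v; rewrite /linform scaler_sumr -big_split /=.
by apply: eq_bigr => i _; rewrite !mxE scalerDl scalerA.
Qed.

(** M^n built from the chosen generators, a form suited to induction on n; [rees_powE] identifies it
    with [rees_pow M n]. *)
Fixpoint power_span n : set {mpoly R[p]} :=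
  if n is k.+1 then gensum xs (power_span k) else mspan [set 1].

Lemma submodule_power_span n : submodule (power_span n).
Proof.
by elim: n => [|n IH] /=; [exact: submodule_mspan|exact: submodule_gensum].
Qed.

Lemma power_span_mul m n f g :
  power_span m f -> power_span n g -> power_span (m + n) (f * g).
Proof.
move=> Pf Pg; rewrite mulrC; move: f Pf.
have sP k : submodule [set f | power_span k (g * f)].
  by apply: submodule_colon; exact: submodule_power_span.
elim: m => [|m IH].
  by apply: (mspan_sub (sP _)) => _ ->; rewrite /= mulr1.
apply: (gensum_sub (sP (m.+1 + n)%N)) => x u xxs Pu /=; rewrite mulrCA.
by apply: mem_gensum => //; [exact: submodule_power_span|exact: IH].
Qed.

Lemma linform_homog (v : 'rV[R]_p) : linform v \is 1.-homog.
Proof.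
apply: rpred_sum => i _; apply: rpredZ; rewrite dhomogX; exact/eqP/mdeg1.
Qed.

Lemma power_span_homog n f : power_span n f -> f \is n.-homog.
Proof.
have sH k : submodule [set f : {mpoly R[p]} | f \is k.-homog].
  apply/submoduleP; split=> [|a u v /= hu hv]; first exact: rpred0.
  by apply: rpredD => //; exact: rpredZ.
elim: n f => [|n IH] f /=.
  by apply: (mspan_sub (sH _)) => _ ->; exact: dhomog1.
apply: (gensum_sub (sH n.+1)) => _ u /mapP[v _ ->] /IH.
exact: (dhomogM (linform_homog v)).
Qed.

Lemma power_span1 v : M v -> power_span 1 (linform v).
Proof.
have sP := submodule_preimage linform_linear (submodule_power_span 1).
apply: (mspan_sub sP) => x /= xX.
rewrite -[linform x]mulr1; apply: mem_gensum; first exact: submodule_mspan.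
  exact: map_f.
exact: sub_mspan.
Qed.

Lemma submodule_rees N : submodule (rees N).
Proof.
apply/submoduleP; split=> [A [[A1 AL _] _]|a u v Ru Rv A hA].
  have : 0 \in mem A.
    by have := AL (-1) 1 1 A1 A1; rewrite scaleN1r addNr.
  exact: set_mem.
have [[_ AL _] _] := hA.
by apply: set_mem; apply: AL; apply: mem_set; [exact: Ru|exact: Rv].
Qed.

Lemma rees1 N : rees N 1.
Proof. by move=> A [[A1 _ _] _]; exact: set_mem. Qed.

Lemma reesM N f g : rees N f -> rees N g -> rees N (f * g).
Proof.
move=> Rf Rg A hA; have [[_ _ AM] _] := hA.
by apply: set_mem; apply: AM; apply: mem_set; [exact: Rf|exact: Rg].
Qed.

Lemma rees_linform N v : N v -> rees N (linform v).
Proof. by move=> Nv; apply: sub_gen_smallest; exists v. Qed.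

Lemma power_span_sub_rees n : power_span n `<=` rees M.
Proof.
have sR := submodule_rees M.
elim: n => [|n IH]; first by apply: (mspan_sub sR) => _ ->; exact: rees1.
apply: (gensum_sub sR) => _ u /mapP[v vX ->] Pu; apply: reesM; last exact: IH.
by apply: rees_linform; exact: sub_mspan.
Qed.

(** The right-hand side contains [M] and is closed under products by [power_span_mul], hence is a
    subalgebra. *)
Lemma rees_sub_power_span : rees M `<=` mspan (\bigcup_n power_span n).
Proof.
set W := mspan _; have sW : submodule W by exact: submodule_mspan.
have W1 n f : power_span n f -> W f by move=> Pf; apply: sub_mspan; exists n.
have sWc g : submodule [set f | W (g * f)] by exact: submodule_colon.
apply: smallest_sub; last first.
  by move=> _ [v Mv <-]; apply: (W1 1); exact: power_span1.
split.
- by apply: mem_set; apply: (W1 0); exact: sub_mspan.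
- move=> a u v /set_mem Wu /set_mem Wv; apply: mem_set.
  by have [_] := (submoduleP _).1 sW; apply.
- move=> f g /set_mem Wf /set_mem Wg; apply: mem_set.
  apply: (mspan_sub (sWc f) _ Wg) => g' [n _ Pg'] /=; rewrite mulrC.
  apply: (mspan_sub (sWc g') _ Wf) => f' [m _ Pf'] /=.
  by apply: (W1 (n + m)%N); exact: power_span_mul.
Qed.

(** Projection to degree n fixes [power_span n] and kills the other [power_span m], whose span
    contains the Rees algebra. *)
Lemma rees_powE n : rees_pow M n = power_span n.
Proof.
apply/seteqP; split=> [f [Rf hf]|f Pf]; last first.
  by split; [exact: power_span_sub_rees Pf|exact: power_span_homog].
rewrite -(pihomog_dE hf).
have sP := submodule_preimage (@pihomog_is_linear p R mdeg n)
  (submodule_power_span n).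
apply: (mspan_sub sP _ (rees_sub_power_span Rf)) => g [m _ Pg] /=.
have hg := power_span_homog Pg; rewrite /preimage/=.
have [mn|mn] := eqVneq m n; first by rewrite pihomog_dE -mn.
by rewrite (pihomog_ne0 mn hg); exact: submodule0 (submodule_power_span n).
Qed.

Lemma power_span_fin_gen n : fin_gen (power_span n).
Proof.
elim: n => [|n [G IH]].
  exists [:: 1]; congr mspan; apply/seteqP.
  by split=> x /=; rewrite inE => /eqP.
exists [seq x * g | x <- xs, g <- G].
apply/seteqP; split; last first.
  apply: mspan_sub; first exact: submodule_power_span n.+1.
  move=> _ /allpairsP[[x g] /= [xxs gG ->]].
  apply: mem_gensum => //; first exact: submodule_power_span.
  by rewrite IH; exact: sub_mspan.
have GP u : power_span n u -> mspan [set` G] u by rewrite IH.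
apply: gensum_sub => [|x u xxs /GP]; first exact: submodule_mspan.
move: u; have sC := submodule_colon x (submodule_mspan [set` [seq x * g | x <- xs, g <- G]]).
apply: (mspan_sub sC) => g gG /=.
by apply: sub_mspan => /=; apply/allpairsP; exists (x, g).
Qed.

Lemma stable_ideal_power I : stable xs (fun n => ideal_mul I (power_span n)).
Proof.
move=> n x u xxs; move: u.
have sC := submodule_colon x (submodule_ideal_mul I (power_span n.+1)).
apply: (ideal_mul_sub sC) => a f Ia Pf /=.
rewrite -scalerAr; apply: mem_ideal_mul => //.
by apply: mem_gensum => //; exact: submodule_power_span.
Qed.

Lemma submodule_mul_rees_pow L N n : submodule (mul_rees_pow L N n).
Proof. exact: submodule_mspan. Qed.

Lemma mem_mul_rees_pow L n v f :
  L v -> power_span n f -> mul_rees_pow L M n (linform v * f).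
Proof.
by rewrite -rees_powE => Lv Pf; apply: sub_mspan; exists v => //; exists f.
Qed.

Lemma mul_rees_pow_sub L n (N : set {mpoly R[p]}) : submodule N ->
  (forall v f, L v -> power_span n f -> N (linform v * f)) ->
  mul_rees_pow L M n `<=` N.
Proof.
move=> sN h; apply: mspan_sub => // _ [v Lv [f Pf <-]].
by apply: h => //; rewrite -rees_powE.
Qed.

(** Degree n holds L M^n / I M^(n+1), so that the generators L / I M sit in degree 0. Lengths are
    finite because this lies inside M^(n+1) / I M^(n+1). *)
Lemma standard_graded_mul_rees L I :
  @finite_length R R^o setT I -> submodule L ->
  ideal_mul I M `<=` L -> L `<=` M ->
  standard_graded xs (fun n => mul_rees_pow L M n)
    (fun n => ideal_mul I (rees_pow M n.+1)).
Proof.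
move=> flI sL IL LM; split.
- move=> n; rewrite rees_powE.
  have sP := submodule_power_span n.+1.
  apply: finite_length_sub (finite_length_ideal_mul flI (power_span_fin_gen n.+1)).
  + exact: submodule_mul_rees_pow.
  + exact: submodule_ideal_mul.
  + by [].
  (* In a (v f) the scalar is moved onto v, and a v is in I M, hence in [L]. *)
  + have sL' := submodule_mul_rees_pow L M n.
    apply: (ideal_mul_sub sL') => a f Ia; move: f.
    have sZ : submodule [set f | mul_rees_pow L M n (a *: f)].
      apply/submoduleP; split=> [|b u v /= hu hv].
        by rewrite /= scaler0; exact: submodule0 sL'.
      rewrite scalerDr scalerA mulrC -scalerA.
      exact: (submoduleD sL' (submoduleZ b sL' hu) hv).
    apply: (gensum_sub sZ) => _ f /mapP[v vX ->] Pf /=.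
    rewrite scalerAl.
    have -> : a *: linform v = linform (a *: v).
      have := linform_linear a v 0; rewrite addr0 => ->.
      have := linform_linear (-1) 0 0.
      by rewrite scaler0 addr0 scaleN1r addNr => ->; rewrite addr0.
    apply: mem_mul_rees_pow => //; apply: IL; apply: mem_ideal_mul => //.
    exact: sub_mspan.
  + apply: (mul_rees_pow_sub sP) => v f Lv Pf; rewrite -add1n.
    by apply: power_span_mul => //; apply: power_span1; exact: LM.
- move=> n x u xxs; move: u.
  have sC := submodule_colon x (submodule_mul_rees_pow L M n.+1).
  apply: (mul_rees_pow_sub sC) => v f Lv Pf /=; rewrite mulrCA.
  apply: mem_mul_rees_pow => //.
  by apply: mem_gensum => //; exact: submodule_power_span.
- by move=> n x u; rewrite !rees_powE; exact: stable_ideal_power.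
- move=> n; apply: subset_trans; last by apply: sumsetl; exact: submodule_ideal_mul.
  have sG := submodule_gensum xs (submodule_mul_rees_pow L M n).
  apply: (mul_rees_pow_sub sG) => v f Lv; move: f.
  have sC := submodule_colon (linform v) sG.
  apply: (gensum_sub sC) => x f xxs Pf /=; rewrite mulrCA.
  apply: mem_gensum => //; first exact: submodule_mul_rees_pow.
  exact: mem_mul_rees_pow.
Qed.

End ReesPowers.

(** * Largest members of families closed under sums *)

Section LargestSubmodule.
Variables (R : comNzRingType) (V : lmodType R).
Implicit Types (A B L : set V).

(** (A1 + A2) / A2 is A1 / (A1 n A2), a quotient of A1 / B, and A2 / B accounts for the rest. *)
Lemma module_length_sumset_le A A1 A2 B l l1 l2 :
  A `<=` sumset A1 A2 -> module_length A1 B l1 -> module_length A2 B l2 ->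
  module_length A B l -> (l <= l1 + l2)%N.
Proof.
move=> AA h1 h2 /module_lengthP[cl _].
have [|sA1 sB BA1] := @finite_length_submodule _ _ A1 B; first by exists l1.
have [|sA2 _ _] := @finite_length_submodule _ _ A2 B; first by exists l2.
have sS := submodule_sumset sA1 sA2.
have [l' cl' /leq_trans] := chain_widen sS sB AA (@subset_refl _ B) cl; apply.
have [m1 [m2 [c1 c2 /leq_trans]]] := chain_cut sA2 (sumsetr sA1) cl'; apply.
have [|_ _ BA2] := @finite_length_submodule _ _ A2 B; first by exists l2.
have /module_lengthP[_ b2] := h2.
have {}c2 : (m2 <= l2)%N by apply: b2; rewrite (setIidl BA2) in c2.
have BA2E : sumset B A2 = A2.
  by apply/seteqP; split; [exact: sumset_sub|exact: sumsetr].
have [l3 [l4 [h3 h4 l1E]]] := module_length_split (submodule_setI sA1 sA2)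
  (fun u Bu => conj (BA1 u Bu) (BA2 u Bu)) (@subIsetl _ _ _) h1.
have id_lin : linear (@idfun V) by [].
have := (module_length_image id_lin l3 sA1 sA2).1 h3; rewrite image_id.
move=> /module_lengthP[_ b3]; rewrite BA2E in c1.
by apply: leq_add => //; rewrite l1E; exact: leq_trans (b3 _ c1) (leq_addr _ _).
Qed.

(** A member that does not contain [L'] grows strictly when [L'] is added; finite length stops this
    growth. *)
Lemma largest_submodule A B (P : set V -> Prop) L :
  finite_length A B ->
  (forall L, P L -> [/\ submodule L, B `<=` L & L `<=` A]) ->
  (forall L1 L2, P L1 -> P L2 -> P (sumset L1 L2)) -> P L ->
  exists L0, P L0 /\ forall L', P L' -> L' `<=` L0.
Proof.
move=> fl PAB PD PL; have [sL BL LA] := PAB _ PL.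
apply: (finite_length_ind (P := fun L => P L -> exists L0, P L0 /\
  forall L', P L' -> L' `<=` L0) fl _ sL BL LA PL) => C sC BC CA IH PC.
have [?|/existsNP[L' /not_implyP[PL' nL']]] :=
  pselect (forall L', P L' -> L' `<=` C); first by exists C.
have [sL' _ L'A] := PAB _ PL'; have PS := PD _ _ PC PL'.
have [sS _ SA] := PAB _ PS.
apply: (IH _ sS SA) => //; split; first exact: sumsetl.
by move=> h; apply: nL'; apply: subset_trans h; exact: sumsetr.
Qed.

End LargestSubmodule.

(** * Existence of the coefficient modules *)

Section CoefficientModules.
Variables (R : comNzRingType) (p : nat) (M : set 'rV[R]_p).
Hypotheses (R_noeth : noetherian R) (M_sub : submodule M) (M_fg : fin_gen M).
Hypothesis M_colength : finite_length setT M.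
Implicit Types L : set 'rV[R]_p.

Let I := fitt0 M.

Let flI : @finite_length R R^o setT I.
Proof. exact: finite_length_fitt0. Qed.

Let mul_rees_graded L : submodule L -> ideal_mul I M `<=` L -> L `<=` M ->
  exists xs, standard_graded xs (fun n => mul_rees_pow L M n)
    (fun n => ideal_mul I (rees_pow M n.+1)).
Proof.
have [X MX] := M_fg; rewrite MX => sL IL LM; eexists.
by apply: standard_graded_mul_rees => //; rewrite -MX.
Qed.

Lemma coef_length_polynomial L :
  submodule L -> ideal_mul I M `<=` L -> L `<=` M ->
  exists P : {poly rat}, exists n0, forall n, (n0 <= n)%N ->
    exists l, coef_length M L n l /\ l%:R = P.[n%:R].
Proof.
move=> sL IL LM; have [xs /hilbert_serre[P [n0 hP]]] := mul_rees_graded sL IL LM.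
(* [coef_length] at n concerns M^(n-1), that is, degree n - 1 of the graded module. *)
exists (P \Po ('X - 1%:P)), n0.+1 => -[//|n] /hP[l [hl lE]].
by exists l; split=> //; rewrite horner_comp !hornerE -natr1 addrK.
Qed.

Lemma mul_rees_pow_sumset_sub L1 L2 n :
  mul_rees_pow (sumset L1 L2) M n
    `<=` sumset (mul_rees_pow L1 M n) (mul_rees_pow L2 M n).
Proof.
apply: mspan_sub.
  by apply: submodule_sumset; exact: submodule_mul_rees_pow.
move=> _ [_ [u Lu [v Lv <-]] [f Pf <-]].
have := @linform_linear R p 1 u v; rewrite !scale1r => ->; rewrite mulrDl.
exists (linform u * f); first by apply: sub_mspan; exists u => //; exists f.
by exists (linform v * f) => //; apply: sub_mspan; exists v => //; exists f.
Qed.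

Lemma coef_admissible_sumset s k L1 L2 :
  coef_admissible M s k L1 -> coef_admissible M s k L2 ->
  coef_admissible M s k (sumset L1 L2).
Proof.
move=> [sL1 IL1 LM1 [e1 [[P1 [[n1 hP1] ->]] le1]]].
move=> [sL2 IL2 LM2 [e2 [[P2 [[n2 hP2] ->]] le2]]].
have sL := submodule_sumset sL1 sL2.
have IL : ideal_mul I M `<=` sumset L1 L2 by apply: subset_trans IL1 _; exact: sumsetl.
have LM : sumset L1 L2 `<=` M by exact: sumset_sub.
split=> //.
have [P [n0 hP]] := coef_length_polynomial sL IL LM.
exists ((size P)%:Z - 1); split; first by exists P; split=> //; exists n0.
(* Lengths are non-negative, so the eventual bound of [P] by [P1 + P2] bounds its size. *)
have : (size P <= maxn (size P1) (size P2))%N.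
  apply: leq_trans (size_polyD P1 P2).
  apply: (@size_eventually_le _ _ (maxn n0 (maxn n1 n2))) => n.
  rewrite !geq_max => /and3P[/hP[l [hl lE]] /hP1[l1 [hl1 l1E]] /hP2[l2 [hl2 l2E]]].
  rewrite hornerD -lE -l1E -l2E -natrD ler0n ler_nat /=.
  exact: module_length_sumset_le (@mul_rees_pow_sumset_sub L1 L2 _) hl1 hl2 hl.
by lia.
Qed.

(** Since (I M) M^(n-1) = I M^n, the polynomial is zero, of degree -1, and -1 <= s - (k+1) is the
    condition k <= s. *)
Lemma coef_admissible_ideal_mul s k : (k <= s)%N ->
  coef_admissible M s k (ideal_mul I M).
Proof.
move=> ks; have sI : submodule (ideal_mul I M) by exact: submodule_ideal_mul.
have IM : ideal_mul I M `<=` M.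
  by apply: ideal_mul_sub => // a x _; exact: submoduleZ.
split=> //; exists (- 1); split; last by lia.
(* At n = 0 the two modules would lie in degrees 1 and 0, since [n.-1] is then 0. *)
exists 0; rewrite size_poly0; split=> //; exists 1%N => -[//|n] _.
exists 0; split; last by rewrite horner0.
have [xs [fl _ _ _]] := mul_rees_graded sI (@subset_refl _ _) IM.
have [sA sB BA] := finite_length_submodule (fl n).
rewrite /coef_length /=.
suff -> : mul_rees_pow (ideal_mul I M) M n = ideal_mul I (rees_pow M n.+1).
  exact: finite_length_refl.
apply/seteqP; split=> //; apply: mspan_sub => // _ [v Iv [f Pf <-]]; move: v Iv.
have sN : submodule [set v | ideal_mul I (rees_pow M n.+1) (linform v * f)].
  apply: (submodule_preimage (f := fun v => linform v * f)) sB => a u v.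
  by rewrite linform_linear mulrDl scalerAl.
apply: (ideal_mul_sub sN) => a x Ia Mx /=.
have -> : linform (a *: x) = a *: linform x.
  have := @linform_linear R p (-1) 0 0.
  have := @linform_linear R p a x 0.
  by rewrite scaler0 !addr0 scaleN1r addNr => -> ->; rewrite addr0.
rewrite -scalerAl; apply: mem_ideal_mul => //.
have [X MX] := M_fg; move: Pf Mx; rewrite MX !rees_powE => Pf Mx.
by rewrite -add1n; apply: power_span_mul => //; exact: power_span1.
Qed.

Lemma coef_module_exists s k : (k <= s)%N -> exists L, coef_module M s k L.
Proof.
move=> ks; apply: (@largest_submodule _ _ M (ideal_mul I M) _ (ideal_mul I M)).
- exact: finite_length_ideal_mul.
- by move=> L [].
- exact: coef_admissible_sumset.
- exact: coef_admissible_ideal_mul.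
Qed.

Lemma coef_admissibleS s k L :
  coef_admissible M s k.+1 L -> coef_admissible M s k L.
Proof. by move=> [sL IL LM [e [he le]]]; split=> //; exists e; split=> //; lia. Qed.

End CoefficientModules.
Theorem theorem4p3 (R : comNzRingType) (m : set R) (d p : nat)
    (M : set 'rV[R]_p) (s : nat)
    (R_noeth : noetherian R) (R_local : local_ring m)
    (R_dim : krull_dim setT [set (0 : R)] d)
    (k_inf : infinite_set (cosets m))
    (p_gt0 : (0 < p)%N)
    (M_sub : submodule M) (M_fg : fin_gen M)
    (M_colength : exists l, module_length setT M l)
    (M_spread : analytic_spread m M s) (s_ge1 : (1 <= s)%N) :
  exists Mk : nat -> set 'rV[R]_p,
    (forall k, (1 <= k <= s)%N -> unique (coef_module M s k) (Mk k)) /\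
    [/\ ideal_mul (fitt0 M) M `<=` Mk s,
        forall k, (1 <= k < s)%N -> Mk k.+1 `<=` Mk k
      & Mk 1%N `<=` M].
Proof.
(* The bound on k stays under the existential so that [choice] gives a total function; beyond s its
   value is a dummy. *)
have ex k : exists L, (k <= s)%N -> coef_module M s k L.
  have [ks|_] := leqP k s; last by exists set0.
  by have [L hL] := coef_module_exists R_noeth M_sub M_fg M_colength ks; exists L.
have [Mk hMk] := choice ex; exists Mk; split=> [k /andP[_ ks]|].
  split=> [|L [adL maxL]]; first exact: hMk.
  by have [adMk maxMk] := hMk k ks; apply/seteqP; split; auto.
split.
- by have [[]] := hMk s (leqnn s).
(* [Mk k.+1] meets the stronger degree bound, so it is among the modules that [Mk k] contains. *)
- move=> k /andP[_ ks]; have [_ maxMk] := hMk k (ltnW ks).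
  by have [/coef_admissibleS adMk _] := hMk k.+1 ks; exact: maxMk.
- by have [[]] := hMk 1%N s_ge1.
Qed.
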